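(* For every integer $d\ge 1$ there exist $2d-1$ matrices $A_1,\ldots,A_{2d-1}\in \mathbf{H}_d(\mathbb{C})$ such that $\mathcal{A}=(A_j)_{j=1}^{2d-1}$ has the almost everywhere phase retrieval property in $\mathbb{C}^d$.
   Context: $\mathbf{H}_d(\mathbb{C})$ is the set of complex Hermitian $d\times d$ matrices. A tuple $\mathcal{A}=(A_j)_{j=1}^N\in \mathbf{H}_d(\mathbb{C})^N$ has the almost everywhere phase retrieval property in $\mathbb{C}^d$ if for Lebesgue-almost every $x\in\mathbb{C}^d$ the following holds: whenever $y\in\mathbb{C}^d$ satisfies $y^{*}A_jy=x^{*}A_jx$ for all $1\le j\le N$, then $y=cx$ for some $c\in\mathbb{C}$ with $|c|=1$. *)

(* Defs.v *)
From HB Require Import structures.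
From mathcomp Require Import all_boot all_order all_algebra.
From mathcomp Require Import sesquilinear spectral complex.
From mathcomp Require Import all_classical all_reals all_analysis.

Set Implicit Arguments.
Unset Strict Implicit.
Unset Printing Implicit Defensive.
Import Order.TTheory GRing.Theory Num.Theory.
Import numFieldNormedType.Exports.

Local Open Scope classical_set_scope.
Local Open Scope ring_scope.
Local Open Scope sesquilinear_scope.
Local Open Scope complex_scope.

Section cons_measure.
Context d (T : measurableType d) (R : realType).
Variables (mu : {sigma_finite_measure set T -> \bar R}) (n : nat).
Variable nu : {sigma_finite_measure set (n.-tuple T) -> \bar R}.

Definition tuple_cons (p : T * n.-tuple T) : n.+1.-tuple T :=
  [tuple of p.1 :: p.2].

Definition cons_measure : set (n.+1.-tuple T) -> \bar R :=
  pushforward (mu \x nu)%E tuple_cons.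

Let cons_measureM := measure_function_pushforward__canonical__measure_function_Measure
  (mu \x nu)%E (@measurable_cons _ _ _ _ fst _ snd measurable_fst measurable_snd
     : measurable_fun setT tuple_cons).

HB.instance Definition _ := isMeasure.Build _ _ _ cons_measure
  (measure0 cons_measureM) (measure_ge0 cons_measureM)
  (@measure_semi_sigma_additive _ _ _ cons_measureM).

Lemma cons_measureE (A : set T) (B : set (n.-tuple T)) :
  measurable A -> measurable B ->
  cons_measure [set t | A (thead t) /\ B [tuple of behead t]]
  = (mu A * nu B)%E.
Proof.
move=> mA mB; rewrite -product_measure1E//; congr ((_ \x _)%E _).
apply/seteqP; split=> -[x t] /= [Ax Bt]; split=> //.
- by move: Bt; rewrite (_ : [tuple of _] = t)//; exact/val_inj.
- by rewrite (_ : [tuple of _] = t)//; exact/val_inj.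
Qed.

Let cons_measure_sigma_finite : sigma_finite setT cons_measure.
Proof.
have /sigma_finiteP[F [TF ndF Foo]] := sigma_finiteT mu.
have /sigma_finiteP[G [TG ndG Goo]] := sigma_finiteT nu.
exists (fun k => [set t | F k (thead t) /\ G k [tuple of behead t]]).
  apply/esym; rewrite -subTset => t _.
  have [i _ Fi] : (\bigcup_k F k) (thead t) by rewrite -TF.
  have [j _ Gj] : (\bigcup_k G k) [tuple of behead t] by rewrite -TG.
  exists (maxn i j) => //; split.
  - by move: Fi; exact/subsetPset/ndF/leq_maxl.
  - by move: Gj; exact/subsetPset/ndG/leq_maxr.
move=> k; have [mF Fk] := Foo k; have [mG Gk] := Goo k; split.
  apply: measurableI; rewrite -[X in measurable X]setTI.
  - exact: (measurable_tnth ord0).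
  - exact: measurable_behead.
by rewrite cons_measureE// lte_mul_pinfty// ge0_fin_numE.
Qed.

HB.instance Definition _ := Measure_isSigmaFinite.Build _ _ _ cons_measure
  cons_measure_sigma_finite.

End cons_measure.

(* The n-fold product measure mu \x ... \x mu, on the product sigma-algebra of
   n.-tuple T; power_measureE below computes it on boxes. *)
Fixpoint power_measure d (T : measurableType d) (R : realType)
    (mu : {sigma_finite_measure set T -> \bar R}) (n : nat) :
    {sigma_finite_measure set (n.-tuple T) -> \bar R} :=
  if n is n'.+1 then cons_measure mu (power_measure mu n')
  else \d_([tuple] : 0.-tuple T).

Lemma power_measureE d (T : measurableType d) (R : realType)
    (mu : {sigma_finite_measure set T -> \bar R}) (n : nat) (A : 'I_n -> set T) :
  (forall i, measurable (A i)) ->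
  power_measure mu n [set t | forall i, A i (tnth t i)]
  = (\prod_(i < n) mu (A i))%E.
Proof.
elim: n A => [|n IH] A mA.
  by rewrite big_ord0 /= diracE mem_set//= => -[].
rewrite big_ord_recl -IH//.
rewrite -cons_measureE//; last first.
  rewrite (_ : mkset _ =
      \bigcap_(i : 'I_n) [set t | A (lift ord0 i) (tnth t i)]).
    apply: fin_bigcap_measurable; first exact: finite_finset.
    move=> i _; rewrite -[X in measurable X]setTI.
    exact: (measurable_tnth i).
  by apply/seteqP; split=> t /= At i => [_|]; exact: At.
congr (cons_measure _ _ _); apply/seteqP; split=> t /= => [At|[At0 At] i].
  by split=> [|i]; [exact: At|move: (At (lift ord0 i)); rewrite [in tnth t _](tuple_eta t) tnthS].
case: (unliftP ord0 i) => [j ->|->//].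
by rewrite [in tnth t _](tuple_eta t) tnthS; exact: At.
Qed.

Definition Cvec (R : realType) (d : nat)
    (u : (d + d).-tuple (measurableTypeR R)) : 'cV[R[i]]_d :=
  \col_(j < d) (tnth u (lshift d j) +i* tnth u (rshift d j)).

(* C^d carries the Lebesgue measure of R^(2d) through the bijection Cvec, which
   reads the first d entries as real parts and the last d as imaginary parts. *)
Definition lebesgue_ae (R : realType) (d : nat)
    (P : 'cV[R[i]]_d -> Prop) : Prop :=
  \forall u \ae power_measure (@lebesgue_measure R) (d + d), P (Cvec u).

Definition quad_form (R : realType) (d : nat) (A : 'M[R[i]]_d)
    (x : 'cV[R[i]]_d) : R[i] := (x ^t* *m A *m x) 0 0.

Definition ae_phase_retrieval (R : realType) (d N : nat)
    (A : 'I_N -> 'M[R[i]]_d) : Prop :=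
  lebesgue_ae (fun x : 'cV[R[i]]_d => forall y : 'cV[R[i]]_d,
    (forall j : 'I_N, quad_form (A j) y = quad_form (A j) x) ->
    exists c : R[i], `|c| = 1 /\ y = c *: x).

(* Main.v *)
Require Import Defs.
From mathcomp Require Import all_boot all_order all_algebra.
From mathcomp Require Import sesquilinear spectral complex.
From mathcomp Require Import all_classical all_reals all_analysis.
From mathcomp Require Import zify ring.
Import Order.TTheory GRing.Theory Num.Theory.
Local Open Scope ring_scope.
Local Open Scope sesquilinear_scope.

(** A vector is determined up to a phase by |x_0|^2 and the products
    conj(x_0) x_k for k >= 1, provided x_0 <> 0: if y has the same values,
    then |y_0| = |x_0|, so that y_0 = c x_0 with |c| = 1, and cancelling
    conj(x_0) in conj(y_0) y_k = conj(x_0) x_k gives y_k = c x_k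
    (cross_products_determine_up_to_phase).

    These data amount to 1 + 2 (d - 1) = 2 d - 1 real numbers, and each is a
    Hermitian form in x.  Indeed conj(x_0) x_k is the form of the matrix unit
    E_0k, and any matrix B is a combination of the Hermitian matrices B + B'
    and i (B - B'), with B' the conjugate transpose of B, so its form can be
    recovered from theirs (quad_form_herm_parts).  For B = E_00 the second of these vanishes, which
    is why 2 d - 1 matrices are enough rather than 2 d.

    The excluded vectors, those with x_0 = 0, are Lebesgue-null because they
    lie in a hyperplane of R^(2d) (lebesgue_ae_coord_neq0). *)

(** The real part of x_i already vanishes only on a coordinate hyperplane of
    R^(2d), which is a box with one side {0} and so has measure 0. *)
Lemma lebesgue_ae_coord_neq0 (R : realType) (d : nat) (i : 'I_d) :
  lebesgue_ae (fun x : 'cV[R[i]]_d => x i 0 != 0).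
Proof.
pose A (k : 'I_(d + d)) : set (measurableTypeR R) :=
  if k == lshift d i then [set 0]%classic else setT.
have mA k : measurable (A k) by rewrite /A; case: ifP.
exists [set t : (d + d).-tuple (measurableTypeR R) |
  forall k, A k (tnth t k)]%classic; split.
- rewrite [X in measurable X](_ : _ =
    (\bigcap_(k : 'I_(d + d)) [set t | A k (tnth t k)])%classic); last first.
    by apply/seteqP; split=> t /= At k => [_|]; exact: At.
  apply: fin_bigcap_measurable; first exact: finite_finset.
  move=> k _; rewrite -[X in measurable X]setTI.
  exact: (measurable_tnth k).
- rewrite power_measureE// (bigD1 (lshift d i))//= {1}/A eqxx.
  by rewrite lebesgue_measure_set1 mul0e.
- move=> u /= /negP; rewrite negbK mxE eq_complex => /andP[/= /eqP ui0 _] k.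
  by rewrite /A; case: eqP => // ->.
Qed.

Lemma lebesgue_aeS (R : realType) (d : nat) (P Q : 'cV[R[i]]_d -> Prop) :
  (forall x, P x -> Q x) -> lebesgue_ae P -> lebesgue_ae Q.
Proof. by move=> PQ; apply: negligibleS => u /= nQ /PQ. Qed.

Section QuadForm.
Context {R : realType} {d : nat}.
Implicit Types (A B : 'M[R[i]]_d) (x y : 'cV[R[i]]_d).

Lemma quad_formD A B x : quad_form (A + B) x = quad_form A x + quad_form B x.
Proof. by rewrite /quad_form mulmxDr mulmxDl mxE. Qed.

Lemma quad_formZ (a : R[i]) A x : quad_form (a *: A) x = a * quad_form A x.
Proof. by rewrite /quad_form -scalemxAr -scalemxAl mxE. Qed.

Lemma quad_form_delta i j x :
  quad_form (delta_mx i j) x = (x i 0)^* * x j 0.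
Proof.
rewrite /quad_form -(mul_delta_mx (0 : 'I_1)) mulmxA -colE -mulmxA -rowE.
by rewrite !mxE big_ord1 !mxE.
Qed.

(** Twice the Hermitian part of B; normalisation is immaterial because the
    matrices only serve to compare values of their forms. *)
Definition herm_re B : 'M[R[i]]_d := B + B ^t*.

(** Minus twice the Hermitian matrix C for which B - i C is Hermitian. *)
Definition herm_im B : 'M[R[i]]_d := 'i *: (B - B ^t*).

Lemma herm_re_hermsym B : herm_re B \is hermsymmx.
Proof.
apply/is_hermitianmxP; rewrite expr0 scale1r.
by apply/matrixP => j k; rewrite !mxE rmorphD /= conjCK addrC.
Qed.

Lemma herm_im_hermsym B : herm_im B \is hermsymmx.
Proof.
apply/is_hermitianmxP; rewrite expr0 scale1r.
apply/matrixP => j k; rewrite !mxE rmorphM rmorphB /= conjCK conjCi.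
by rewrite mulNr -mulrN opprB.
Qed.

Lemma herm_im_delta_diag i : herm_im (delta_mx i i) = 0.
Proof.
apply/matrixP => j k; rewrite !mxE rmorph_nat [(k == i) && _]andbC.
by rewrite subrr mulr0.
Qed.

(** Holds because 2 B = (B + B') - i (i (B - B')), with B' the conjugate
    transpose of B, and the form is linear in its matrix. *)
Lemma quad_form_herm_parts B x y :
  quad_form (herm_re B) y = quad_form (herm_re B) x ->
  quad_form (herm_im B) y = quad_form (herm_im B) x ->
  quad_form B y = quad_form B x.
Proof.
move=> eq_re eq_im.
have parts z : quad_form (herm_re B) z - 'i * quad_form (herm_im B) z
             = 2 * quad_form B z.
  rewrite -mulNr -!quad_formZ -quad_formD; congr (quad_form _ z).
  rewrite /herm_re /herm_im scalerA mulNr -expr2 sqrCi opprK scale1r.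
  by rewrite addrACA subrr addr0 scaler_nat mulr2n.
have two_neq0 : (2 : R[i]) != 0 by rewrite pnatr_eq0.
by apply: (mulfI two_neq0); rewrite -!parts eq_re eq_im.
Qed.

(** Taking k = i gives |y_i| = |x_i|, which makes c = y_i / x_i a phase; the
    other products then transport c to every coordinate. *)
Lemma cross_products_determine_up_to_phase i x y : x i 0 != 0 ->
  (forall k, (y i 0)^* * y k 0 = (x i 0)^* * x k 0) ->
  exists c : R[i], `|c| = 1 /\ y = c *: x.
Proof.
move=> xi0 eq_cross.
have eq_norm : `|y i 0| = `|x i 0|.
  by apply/eqP; rewrite -(eqrXn2 (n := 2)) // !normCK mulrC eq_cross mulrC.
exists (y i 0 / x i 0); split.
  by rewrite normrM normfV eq_norm divff // normr_eq0.
apply/colP => k; rewrite mxE mulrAC; apply: (mulIf xi0); rewrite divfK //.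
have xiC0 : (x i 0)^* != 0 by rewrite conjC_eq0.
apply: (mulfI xiC0).
rewrite mulrCA -eq_cross [RHS]mulrCA -eq_cross; ring.
Qed.

End QuadForm.

Local Open Scope complex_scope.

Theorem theorem1p4 (R : realType) (d : nat) (d_ge1 : (1 <= d)%N) :
  exists A : 'I_(2 * d - 1) -> 'M[R[i]]_d,
    (forall j : 'I_(2 * d - 1), A j \is hermsymmx) /\ ae_phase_retrieval A.
Proof.
case: d d_ge1 => [//|n] _.
pose B (k : nat) : 'M[R[i]]_n.+1 := delta_mx ord0 (inord k).
(* Indices 0, ..., n carry the real parts for all of E_00, ..., E_0n; the n
   remaining ones n + k carry the imaginary parts for k >= 1 only. *)
pose A (j : nat) := if (j <= n)%N then herm_re (B j) else herm_im (B (j - n)%N).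
exists (fun j => A j); split=> [j|].
  by rewrite /A; case: ifP => _; [exact: herm_re_hermsym|exact: herm_im_hermsym].
apply: lebesgue_aeS (lebesgue_ae_coord_neq0 R n.+1 ord0) => x x00 y eq_quad.
apply: (cross_products_determine_up_to_phase ord0 x y x00) => k.
have eqA j : (j < 2 * n.+1 - 1)%N -> quad_form (A j) y = quad_form (A j) x.
  by move=> ltj; exact: (eq_quad (Ordinal ltj)).
rewrite -!quad_form_delta -[k]inord_val -/(B k).
have le_kn : (k <= n)%N by rewrite -ltnS.
apply: quad_form_herm_parts.
  by have := eqA k; rewrite /A le_kn; apply; lia.
have [k0|k_gt0] := posnP k.
  have -> : B k = delta_mx ord0 ord0.
    by congr delta_mx; apply: val_inj; rewrite /= inordK.
  by rewrite herm_im_delta_diag /quad_form !mulmx0 !mul0mx.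
have := eqA (n + k)%N; rewrite /A ifF; last by lia.
by rewrite addKn; apply; lia.
Qed.
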